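(* Let $\mathbf S$ be a finite set of cardinality $N$, let $n\in\{1,\dots,N-1\}$, let $\Omega=\binom{\mathbf S}{n}$ be the set of all subsets of $\mathbf S$ of cardinality $n$, let $\mathbf P$ be the uniform distribution on $\Omega$, and for $k\in\{1,\dots,n\}$ let $T_k$ be the Markov operator of the $(n\leftrightarrow n-k)$ down-up walk on $\Omega$. For any $\theta=(\theta_1,\dots,\theta_n)$ with $\theta_k\ge0$ and $\sum_{k=1}^n\theta_k=1$, and for any $f:\Omega\to\mathbb R_+$, $$\sum_{k=1}^n\theta_k\,\mathrm{Ent}(T_kf)\le(1-\kappa)\,\mathrm{Ent}(f),$$ with $\kappa:=\kappa_0(\theta)+\kappa_1(\theta)$, where $$\kappa_0(\theta):=\sum_{k=1}^n\theta_k\,\frac kn,\qquad \kappa_1(\theta):=\sum_{k=1}^n\theta_k\,\frac{k}{N-(n-k)}\Big(1-\frac kn\Big).$$ In particular, for any $k=1,\dots,n$, the $(n\leftrightarrow n-k)$ down-up walk for uniform $n$-sets has entropy contraction with rate $\frac kn+\frac{k}{N-(n-k)}\big(1-\frac kn\big)$, i.e. for every $f:\Omega\to\mathbb R_+$, $$\mathrm{Ent}(T_kf)\le\Big(1-\frac kn-\frac{k}{N-(n-k)}\Big(1-\frac kn\Big)\Big)\mathrm{Ent}(f).$$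
   Context: $\mathrm{Ent}(f)=\mathbf E[f\log f]-\mathbf E[f]\log\mathbf E[f]$, with $\mathbf E$ the expectation under $\mathbf P$. The operator $T_k$ is $T_kf(X)=\sum_{X'\in\Omega}T_k(X,X')f(X')$, where $T_k(X,X')$ is the probability of moving from $X$ to $X'$ in the following step: given $X\in\Omega$, let $X_{-k}$ be a uniformly random subset of $X$ of cardinality $n-k$; then, given $X_{-k}$, let $X'$ be a uniformly random superset of $X_{-k}$ in $\mathbf S$ of cardinality $n$ (equivalently, remove $k$ uniformly random elements from $X$ and then add $k$ elements chosen uniformly at random from $\mathbf S\setminus X_{-k}$). *)

(* Defs.v *)
From HB Require Import structures.
From mathcomp Require Import all_boot all_order all_algebra.
From mathcomp Require Import reals exp.

Set Implicit Arguments.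
Unset Strict Implicit.
Unset Printing Implicit Defensive.

Import Order.TTheory GRing.Theory Num.Theory.
Local Open Scope ring_scope.

Definition nset (S : finType) (n : nat) : Type := {X : {set S} | #|X| == n}.

HB.instance Definition _ (S : finType) (n : nat) := SubFinite.on (nset S n).

Definition unif (R : realType) (T : finType) (A : {set T}) (x : T) : R :=
  (x \in A)%:R / #|A|%:R.

Definition expect (R : realType) (T : finType) (P : T -> R) (f : T -> R) : R :=
  \sum_(x : T) P x * f x.

(* The library sets [ln 0 = 0], so the convention [0 log 0 = 0] holds. *)
Definition entropy (R : realType) (T : finType) (P : T -> R) (f : T -> R) : R :=
  expect P (fun x => f x * ln (f x)) - expect P f * ln (expect P f).

Definition markov_op (R : realType) (T : finType) (K : T -> T -> R)
    (f : T -> R) : T -> R :=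
  fun x => \sum_(y : T) K x y * f y.

Definition entropy_contraction (R : realType) (T : finType) (P : T -> R)
    (K : T -> T -> R) (r : R) : Prop :=
  forall f : T -> R, (forall x, 0 <= f x) ->
    entropy P (markov_op K f) <= (1 - r) * entropy P f.

Section DownUp.
Variables (R : realType) (S : finType) (n : nat).

(* In both steps [m] is the size of the intermediate set. *)
Definition down_step (m : nat) (X : nset S n) (Y : nset S m) : R :=
  unif R [set Z : nset S m | val Z \subset val X] Y.

Definition up_step (m : nat) (Y : nset S m) (X : nset S n) : R :=
  unif R [set Z : nset S n | val Y \subset val Z] X.

(* The subtraction [n - k] is truncated; the walk is meant for [k <= n]. *)
Definition down_up (k : nat) (X X' : nset S n) : R :=
  \sum_(Y : nset S (n - k)) down_step X Y * up_step Y X'.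

Definition unif_nset : nset S n -> R := unif R [set: nset S n].

End DownUp.

Arguments down_up R S n k X X' : clear implicits.
Arguments unif_nset R S n _ : clear implicits.

Definition kappa0 (R : realType) (n : nat) (theta : nat -> R) : R :=
  \sum_(1 <= k < n.+1) theta k * (k%:R / n%:R).

Definition kappa1 (R : realType) (N n : nat) (theta : nat -> R) : R :=
  \sum_(1 <= k < n.+1)
    theta k * (k%:R / (N%:R - (n%:R - k%:R)) * (1 - k%:R / n%:R)).

(* Main.v *)
Require Import Defs.
From mathcomp Require Import all_boot all_order all_algebra.
From mathcomp Require Import reals exp.
From mathcomp Require Import ring lra zify.
From mathcomp Require boolp.

Set Implicit Arguments.
Unset Strict Implicit.
Unset Printing Implicit Defensive.

Import Order.TTheory GRing.Theory Num.Theory.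
Local Open Scope ring_scope.

(** The down-up walk first averages [f] over the [n]-sets containing a given
    [m]-set, [m = n - k], then averages the result over the [m]-subsets of an
    [n]-set.  Each half contracts entropy, by [m / n] ([entropy_up]) and by
    [(N - n) / (N - m)] ([entropy_down]) respectively, and the product of these
    two factors is exactly one minus the stated rate.  The weighted inequality
    is then the convex combination of the bounds for the single values of [k].

    The two halves are the same fact: complementation turns an average over
    subsets into an average over supersets, so [entropy_down] is [entropy_up]
    for [(N - n, N - m)] in place of [(m, n)].

    For [entropy_up], averaging over supersets is iterated one element at a
    time by [up_avg], and [iter_up_avg] identifies the iterates.  Let [d j] be
    the entropy at level [j] of the average of [f].  As [d 0 = 0], the bound
    [n * d m <= m * d n] follows once [d] is convex in [j].  Convexity compares
    three consecutive levels, hence can be checked above each fixed set [Z] of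
    size [j]: the function [h x y] given by adding two distinct points to [Z]
    is symmetric, and what is needed is [pair_entropy], namely that its relative
    entropy with respect to uniform pairs of distinct points is at least twice
    that of its marginal [q].  Writing [a] for the mean of [q], the tangent
    line bound for the logarithm compares [h x y] with the product
    [q x * q y / a]; the sign is right because sampling without replacement is
    negatively correlated, which is [avg_pair_prod]. *)

Local Notation avg A := (expect (unif _ A)).

(** * Uniform averages *)

Lemma expectD (R : realType) (T : finType) (P f g : T -> R) :
  expect P (fun x => f x + g x) = expect P f + expect P g.
Proof.
by rewrite /expect -big_split; apply: eq_bigr => x _; rewrite mulrDr.
Qed.

Lemma expectZ (R : realType) (T : finType) (P f : T -> R) (c : R) :
  expect P (fun x => c * f x) = c * expect P f.
Proof. by rewrite /expect mulr_sumr; apply: eq_bigr => x _; rewrite mulrCA. Qed.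

Lemma expectN (R : realType) (T : finType) (P f : T -> R) :
  expect P (fun x => - f x) = - expect P f.
Proof. by rewrite /expect -sumrN; apply: eq_bigr => x _; rewrite mulrN. Qed.

Lemma avgE (R : realType) (T : finType) (A : {set T}) (f : T -> R) :
  avg A f = (\sum_(x in A) f x) / #|A|%:R.
Proof.
rewrite /expect mulr_suml [RHS]big_mkcond; apply: eq_bigr => x _.
by rewrite /unif; case: (x \in A); rewrite ?mul0r// mul1r mulrC.
Qed.

Lemma eq_avg (R : realType) (T : finType) (A : {set T}) (f g : T -> R) :
  {in A, f =1 g} -> avg A f = avg A g.
Proof. by move=> fg; rewrite !avgE (eq_bigr g). Qed.

Lemma avg_ge0 (R : realType) (T : finType) (A : {set T}) (f : T -> R) :
  {in A, forall x, 0 <= f x} -> 0 <= avg A f.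
Proof. by move=> f0; rewrite avgE divr_ge0 ?sumr_ge0. Qed.

Lemma avg_cst (R : realType) (T : finType) (A : {set T}) (c : R) :
  (0 < #|A|)%N -> avg A (fun=> c) = c.
Proof.
by move=> A0; rewrite avgE sumr_const -(mulr_natr c) mulfK// pnatr_eq0 -lt0n.
Qed.

Lemma avg_imset (R : realType) (T T' : finType) (h : T -> T') (A : {set T})
    (f : T' -> R) : injective h -> avg (h @: A) f = avg A (f \o h).
Proof.
by move=> h_inj; rewrite !avgE card_imset// big_imset//; apply: in2W.
Qed.

Lemma eq_entropy_avg (R : realType) (T : finType) (A : {set T}) (f g : T -> R) :
  {in A, f =1 g} -> entropy (unif R A) f = entropy (unif R A) g.
Proof.
move=> fg; rewrite /entropy (eq_avg fg); congr (_ - _).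
by apply: eq_avg => x /fg ->.
Qed.

Lemma entropy_imset (R : realType) (T T' : finType) (h : T -> T') (A : {set T})
    (f : T' -> R) : injective h ->
  entropy (unif R (h @: A)) f = entropy (unif R A) (f \o h).
Proof. by move=> h_inj; rewrite /entropy !avg_imset. Qed.

(** * Ordered pairs of distinct points *)

(** The ordered pair of distinct points drawn uniformly from [D] is
    exchangeable. *)
Lemma avg_pairC (R : realType) (T : finType) (D : {set T}) (h : T -> T -> R) :
  avg D (fun x => avg (D :\ x) (h x)) =
  avg D (fun x => avg (D :\ x) (fun y => h y x)).
Proof.
have E (k : T -> T -> R) : avg D (fun x => avg (D :\ x) (k x)) =
    (\sum_(x in D) \sum_(y in D | y != x) k x y) / (#|D|.-1%:R * #|D|%:R).
  rewrite avgE invfM mulrA; congr (_ / _).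
  rewrite mulr_suml; apply: eq_bigr => x xD.
  rewrite avgE (cardsD1 x D) xD /=; congr (_ / _).
  by apply: eq_bigl => y; rewrite !inE andbC.
rewrite !E; congr (_ / _).
rewrite (exchange_big_dep (mem D))//=; last by move=> x y _ /andP[].
apply: eq_bigr => y yD; apply: eq_bigl => x.
by rewrite -[y \in D]/(mem D y) /= yD eq_sym.
Qed.

(** Negative correlation: if [M] is the cardinal of [D] and [a] the mean of
    [q], removing [x] leaves the mean [(M * a - q x) / (M - 1)], so that the
    claim reduces to [a ^+ 2] being at most the mean of the squares. *)
Lemma avg_pair_prod (R : realType) (T : finType) (D : {set T}) (q : T -> R) :
  avg D (fun x => avg (D :\ x) (fun y => q x * q y)) <= avg D q ^+ 2.
Proof.
set a := avg D q.
(* With at most one point there are no pairs, and the averages are zero. *)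
have [D1|D1] := leqP #|D| 1.
  rewrite (eq_avg (g := fun=> 0 * 0)) ?expectZ ?mul0r ?sqr_ge0// => x xD.
  suff -> : D :\ x = set0 by rewrite /= avgE big_set0 !mul0r.
  apply/eqP; rewrite -cards_eq0; move: D1; rewrite (cardsD1 x D) xD.
  by case: #|_|.
pose M : R := #|D|%:R.
have M1 : 0 < M - 1 by rewrite subr_gt0 ltr1n.
have sumq : \sum_(x in D) q x = M * a.
  by rewrite /a avgE mulrC divfK// pnatr_eq0; case: #|D| D1.
have sqE : a ^+ 2 <= avg D (fun x => q x ^+ 2).
  suff : 0 <= avg D (fun x => (q x - a) ^+ 2).
    rewrite (eq_avg (g := fun x => q x ^+ 2 + (- (2 * a) * q x + a ^+ 2))).
      rewrite expectD expectD expectZ avg_cst ?(ltnW D1)// -/a; lra.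
    by move=> x _; ring.
  by apply: avg_ge0 => x _; exact: sqr_ge0.
have -> : avg D (fun x => avg (D :\ x) (fun y => q x * q y)) =
    avg D (fun x => (M - 1)^-1 * (M * a * q x + - q x ^+ 2)).
  apply: eq_avg => x xD; rewrite expectZ avgE.
  have -> : \sum_(y in D :\ x) q y = M * a - q x.
    by rewrite -sumq [in RHS](big_setD1 x)//= addrC addrK.
  have -> : #|D :\ x|%:R = M - 1.
    by rewrite /M (cardsD1 x D) xD natrD addrAC subrr add0r.
  by field; rewrite lt0r_neq0.
rewrite expectZ expectD expectZ expectN -/a ler_pdivrMl//.
nra.
Qed.

(** * Local inequality *)

Definition xlnx (R : realType) (t : R) : R := t * ln t.

(** This is [ln t <= t - 1] at [t = u * v / (a * h)], times [h].  The last
    hypothesis asks only for absolute continuity, so that degenerate values of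
    the marginals are covered. *)
Lemma entropy_tangent (R : realType) (h u v a : R) :
  0 <= h -> 0 <= u -> 0 <= v -> 0 <= a ->
  (h != 0 -> [/\ u != 0, v != 0 & a != 0]) ->
  h - u * v / a <= h * (ln h - ln u - ln v + ln a).
Proof.
move=> h0 u0 v0 a0; have [->|hN0] := eqVneq h 0.
  by move=> _; rewrite mul0r sub0r oppr_le0 divr_ge0 ?mulr_ge0.
case=> // uN0 vN0 aN0.
have [{}h0 {}u0 {}v0 {}a0] : [/\ 0 < h, 0 < u, 0 < v & 0 < a].
  by split; rewrite lt_neqAle eq_sym ?h0 ?u0 ?v0 ?a0 andbT.
have uv0 : 0 < u * v by rewrite mulr_gt0.
have ah0 : 0 < a * h by rewrite mulr_gt0.
have p0 : 0 < u * v / (a * h) by rewrite divr_gt0.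
have := le_ln1Dx (x := u * v / (a * h) - 1).
rewrite (addrC 1) subrK ltrBrDl subrr => /(_ p0).
rewrite ln_div ?posrE// !lnM ?posrE// => L.
have -> : h - u * v / a = h * (1 - u * v / (a * h)).
  by field; rewrite hN0 aN0.
rewrite ler_pM2l//; lra.
Qed.

(** Average [entropy_tangent] over the pairs, with the product of the marginals
    [q x * q y / a] as reference.  The two logarithms of marginals contribute
    equally by exchangeability, and the remaining linear terms are
    [a] minus the average of [q x * q y / a], nonnegative by
    [avg_pair_prod]. *)
Lemma pair_entropy (R : realType) (T : finType) (D : {set T})
    (h : T -> T -> R) (q : T -> R) :
  (forall x y, 0 <= h x y) -> (forall x y, h x y = h y x) ->
  (forall x, q x = avg (D :\ x) (h x)) ->
  2 * avg D (fun x => xlnx (q x)) <=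
  avg D (fun x => avg (D :\ x) (fun y => xlnx (h x y))) + xlnx (avg D q).
Proof.
move=> h0 hC qE; set a := avg D q.
have q0 x : 0 <= q x by rewrite qE; apply: avg_ge0.
have a0 : 0 <= a by apply: avg_ge0.
have avg_neq0 (A : {set T}) (g : T -> R) x : (forall y, 0 <= g y) -> x \in A ->
    g x != 0 -> avg A g != 0.
  move=> g0 xA; apply: contra_neq; rewrite avgE => /eqP.
  rewrite mulf_eq0 invr_eq0 pnatr_eq0 cards_eq0.
  case/orP => [|/eqP A0]; last by rewrite A0 inE in xA.
  rewrite psumr_eq0// => /allP/(_ x).
  by rewrite mem_index_enum xA => /(_ isT)/eqP.
have T1 : avg D (fun x => avg (D :\ x) (fun y => h x y * ln (q x))) =
    avg D (fun x => xlnx (q x)).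
  apply: eq_avg => x _; rewrite /xlnx {2}qE mulrC -expectZ.
  by apply: eq_avg => y _; rewrite mulrC.
have T2 : avg D (fun x => avg (D :\ x) (fun y => h x y * ln (q y))) =
    avg D (fun x => xlnx (q x)).
  rewrite avg_pairC -T1; apply: eq_avg => x _.
  by apply: eq_avg => y _; rewrite hC.
have : 0 <= avg D (fun x => avg (D :\ x) (fun y =>
    xlnx (h x y) + (- (h x y * ln (q x)) + (- (h x y * ln (q y)) +
      ((ln a - 1) * h x y + a^-1 * (q x * q y)))))).
  apply: avg_ge0 => x xD; apply: avg_ge0 => y yDx.
  have yD : y \in D by move: yDx; rewrite !inE => /andP[].
  have xDy : x \in D :\ y by move: yDx; rewrite !inE xD eq_sym => /andP[->].
  have -> : xlnx (h x y) + (- (h x y * ln (q x)) + (- (h x y * ln (q y)) +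
      ((ln a - 1) * h x y + a^-1 * (q x * q y)))) =
      h x y * (ln (h x y) - ln (q x) - ln (q y) + ln a) -
      (h x y - q x * q y / a) by rewrite /xlnx; ring.
  rewrite subr_ge0; apply: entropy_tangent => // hN0.
  have qxN0 : q x != 0 by rewrite qE; apply: (avg_neq0 _ _ y).
  split=> //; first by rewrite qE; apply: (avg_neq0 _ _ x); rewrite // hC.
  exact: (avg_neq0 _ _ x).
have splitE : {in D, forall x, avg (D :\ x) (fun y =>
    xlnx (h x y) + (- (h x y * ln (q x)) + (- (h x y * ln (q y)) +
      ((ln a - 1) * h x y + a^-1 * (q x * q y))))) =
    avg (D :\ x) (fun y => xlnx (h x y)) +
    (- avg (D :\ x) (fun y => h x y * ln (q x)) +
    (- avg (D :\ x) (fun y => h x y * ln (q y)) +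
      ((ln a - 1) * q x + a^-1 * avg (D :\ x) (fun y => q x * q y))))}.
  move=> x _; rewrite 4!expectD !expectN.
  by rewrite (expectZ _ _ (ln a - 1)) (expectZ _ _ a^-1) -(qE x).
rewrite (eq_avg splitE) 4!expectD !expectN 2!expectZ T1 T2 -/a.
have : a^-1 * avg D (fun x => avg (D :\ x) (fun y => q x * q y)) <= a.
  have [->|aN0] := eqVneq a 0; first by rewrite invr0 mul0r.
  have {aN0}a_gt0 : 0 < a by rewrite lt_neqAle eq_sym aN0.
  rewrite ler_pdivrMl// -expr2.
  exact: avg_pair_prod.
by rewrite /xlnx; lra.
Qed.

(** * Averaging over supersets *)

Definition up_avg (R : realType) (S : finType) (g : {set S} -> R) :
    {set S} -> R :=
  fun Y => avg (~: Y) (fun x => g (x |: Y)).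

Definition supersets (S : finType) (n : nat) (Y : {set S}) : {set {set S}} :=
  [set X : {set S} | (Y \subset X) && (#|X| == n)].

Definition level (S : finType) (n : nat) : {set {set S}} :=
  [set X : {set S} | #|X| == n].

Arguments level S n : clear implicits.

Lemma supersets_set0 (S : finType) (n : nat) : supersets n set0 = level S n.
Proof. by apply/setP => X; rewrite !inE sub0set. Qed.

Lemma iter_up_avg_ge0 (R : realType) (S : finType) (f : {set S} -> R) k Y :
  (forall X, 0 <= f X) -> 0 <= iter k (@up_avg R S) f Y.
Proof.
move=> f0; elim: k Y => [|k IH] Y //=.
by apply: avg_ge0 => x _; exact: IH.
Qed.

Lemma iter_up_avg_cst (R : realType) (S : finType) k (Y : {set S}) :
  (#|Y| + k <= #|S|)%N -> iter k (@up_avg R S) (fun=> 1) Y = 1.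
Proof.
elim: k Y => [//|k IH] Y; rewrite addnS => YS /=; rewrite /up_avg.
rewrite (eq_avg (g := fun=> 1)) ?avg_cst//.
  by rewrite cardsCs setCK subn_gt0; apply: leq_ltn_trans YS; rewrite leq_addr.
by move=> x; rewrite inE => xY; rewrite IH// cardsU1 xY.
Qed.

(** Double counting: a set [X] of size [n] above [Y] is reached through each of
    the [k] points of [X :\: Y]. *)
Lemma sum_supersets (R : realType) (S : finType) (f : {set S} -> R) n k
    (Y : {set S}) : (#|Y| + k = n)%N ->
  \sum_(x in ~: Y) \sum_(X in supersets n (x |: Y)) f X =
  k%:R * \sum_(X in supersets n Y) f X.
Proof.
move=> Yk; rewrite (exchange_big_dep [in supersets n Y])/=; last first.
  move=> x X _; rewrite !inE.
  by rewrite subUset => /andP[/andP[_ ->] ->].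
rewrite mulr_sumr; apply: eq_bigr => X; rewrite !inE => /andP[YX Xn].
rewrite (eq_bigl (mem (X :\: Y))) => [|x]; last first.
  by rewrite /= !inE subUset sub1set YX Xn !andbT.
rewrite sumr_const mulr_natl; congr (_ *+ _).
by rewrite cardsD (setIidPr YX) (eqP Xn) -Yk addKn.
Qed.

(** By [sum_supersets] the iterate is a constant [c], the same for all [Y],
    times the sum over supersets; evaluating at the constant function [1], which
    averaging preserves, identifies [c] without computing the number of
    supersets. *)
Lemma iter_up_avg (R : realType) (S : finType) (f : {set S} -> R) n k
    (Y : {set S}) : (n <= #|S|)%N -> (#|Y| + k = n)%N ->
  iter k (@up_avg R S) f Y = avg (supersets n Y) f.
Proof.
move=> nS Yk.
have [c cE] : exists c : R, forall (g : {set S} -> R) (Z : {set S}),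
    (#|Z| + k = n)%N ->
    iter k (@up_avg R S) g Z = c * \sum_(X in supersets n Z) g X.
  elim: k {Y Yk} => [|k [c IH]].
    exists 1 => g Z; rewrite addn0 mul1r => Zn.
    rewrite (big_pred1 Z)// => X; rewrite !inE [RHS]eq_sym eqEcard Zn /=.
    case: (Z \subset X) / boolP => //= ZX; rewrite eqn_leq -Zn.
    by rewrite (subset_leq_card ZX) andbT.
  (* [n - k.+1] is the size of [Z], so one divides by the number of points
     outside [Z]. *)
  exists (c * (k.+1%:R / (#|S| - (n - k.+1))%:R)) => g Z Zk /=.
  rewrite /up_avg (eq_avg (g := fun x =>
    c * \sum_(X in supersets n (x |: Z)) g X)).
    rewrite expectZ avgE (sum_supersets g Zk) -Zk addnK (cardsCs (~: Z)) setCK.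
    by rewrite -!mulrA; congr (_ * (_ * _)); rewrite mulrC.
  by move=> x; rewrite inE => xZ; rewrite IH// cardsU1 xZ -Zk addnS.
have c1 : c * #|supersets n Y|%:R = 1.
  have := cE (fun=> 1) Y Yk; rewrite iter_up_avg_cst ?Yk// => /esym.
  by rewrite sumr_const.
rewrite cE// avgE mulrC; congr (_ * _).
have sN0 : #|supersets n Y|%:R != 0 :> R.
  by apply: contra_eq_neq c1 => ->; rewrite mulr0 eq_sym oner_neq0.
by apply: (mulIf sN0); rewrite c1 mulVf.
Qed.

Lemma iter_up_avg_set0 (R : realType) (S : finType) (f : {set S} -> R) n :
  (n <= #|S|)%N -> iter n (@up_avg R S) f set0 = avg (level S n) f.
Proof.
by move=> nS; rewrite (iter_up_avg f nS) ?cards0// supersets_set0.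
Qed.

(** Picking a uniform [n]-set and then a uniform new point gives a uniform
    [n.+1]-set; both sides are the [n.+1]-st iterate of [up_avg] at the empty
    set. *)
Lemma avg_level_up (R : realType) (S : finType) (f : {set S} -> R) n :
  (n < #|S|)%N -> avg (level S n) (up_avg f) = avg (level S n.+1) f.
Proof.
by move=> nS; rewrite -!iter_up_avg_set0 ?(ltnW nS)// iterSr.
Qed.

(** * Contraction of entropy *)

(** The local form of convexity of the entropy along the levels: [pair_entropy]
    on the complement of [Z]. *)
Lemma up_avg_xlnx (R : realType) (S : finType) (g : {set S} -> R) Z :
  (forall X, 0 <= g X) ->
  2 * up_avg (fun Y => xlnx (up_avg g Y)) Z <=
  up_avg (up_avg (fun X => xlnx (g X))) Z + xlnx (up_avg (up_avg g) Z).
Proof.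
move=> g0; have DE x : ~: (x |: Z) = ~: Z :\ x.
  by apply/setP => y; rewrite !inE negb_or.
have -> : up_avg (up_avg (fun X => xlnx (g X))) Z = avg (~: Z) (fun x =>
    avg (~: Z :\ x) (fun y => xlnx (g (y |: (x |: Z))))).
  by apply: eq_avg => x _; rewrite /up_avg DE.
apply: pair_entropy => // [x y|x]; first by rewrite setUCA.
by rewrite /up_avg DE.
Qed.

(** Convexity makes [d j / j] nondecreasing; the proof by induction is on
    consecutive indices, with the denominators cleared. *)
Lemma convex_seq (R : realType) (d : nat -> R) n m : d 0%N = 0 ->
  (forall j, (j.+2 <= n)%N -> 2 * d j.+1 <= d j.+2 + d j) ->
  (m <= n)%N -> n%:R * d m <= m%:R * d n.
Proof.
move=> d0 dconv.
have step j : (j < n)%N -> j.+1%:R * d j <= j%:R * d j.+1.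
  elim: j => [|j IH] jn; first by rewrite d0 mulr0 mul0r.
  have := IH (ltnW jn); have := dconv j jn.
  by rewrite -!natr1; have : 0 <= j%:R :> R by []; nra.
elim: n {dconv} step => [|n IH] step; first by rewrite leqn0 => /eqP ->.
rewrite leq_eqVlt => /predU1P[-> //|]; rewrite ltnS => mn.
have [n0|n0] := posnP n.
  by move: mn; rewrite n0 leqn0 => /eqP ->; rewrite d0 mulr0 mul0r.
have {}IH := IH (fun j jn => step j (leqW jn)) mn.
rewrite -(ler_pM2l (_ : 0 < n%:R)) ?ltr0n//.
apply: le_trans (_ : n.+1%:R * (m%:R * d n) <= _).
  by rewrite mulrCA ler_wpM2l.
by rewrite mulrCA [leRHS]mulrCA ler_wpM2l// step.
Qed.

(** The averages of [f] have the same mean at every level, so that convexity of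
    the entropy follows from [up_avg_xlnx] averaged over a level, where
    [avg_level_up] turns it into a comparison of three levels. *)
Theorem entropy_up (R : realType) (S : finType) (f : {set S} -> R) n m :
  (forall X, 0 <= f X) -> (m <= n)%N -> (n <= #|S|)%N ->
  n%:R * entropy (unif R (level S m)) (iter (n - m) (@up_avg R S) f) <=
  m%:R * entropy (unif R (level S n)) f.
Proof.
move=> f0 mn nS.
pose fl j := iter (n - j) (@up_avg R S) f.
pose d j := entropy (unif R (level S j)) (fl j).
have flS j : (j < n)%N -> up_avg (fl j.+1) = fl j.
  by move=> jn; rewrite /fl -iterS subnSK.
have mean j : (j <= n)%N -> avg (level S j) (fl j) = fl 0%N set0.
  move=> jn; rewrite -iter_up_avg_set0 ?(leq_trans jn)// /fl -iterD.
  by rewrite subnKC ?subn0.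
suff : n%:R * d m <= m%:R * d n by rewrite /d /fl subnn.
apply: convex_seq => // [|j jn].
  rewrite /d /entropy; have level0 (g : {set S} -> R) :
      avg (level S 0) g = g set0.
    by rewrite -iter_up_avg_set0.
  by rewrite !level0 subrr.
have jn1 := ltnW jn; have jn0 := ltnW jn1.
rewrite /d /entropy !mean//.
suff : 2 * avg (level S j.+1) (fun Y => xlnx (fl j.+1 Y)) <=
    avg (level S j.+2) (fun X => xlnx (fl j.+2 X)) +
    avg (level S j) (fun Z => xlnx (fl j Z)) by rewrite /xlnx; lra.
have jS := leq_trans jn nS.
rewrite -!avg_level_up ?(ltnW jS)// -subr_ge0 -expectZ -expectD -expectN.
rewrite -expectD; apply: avg_ge0 => Z _; rewrite subr_ge0.
rewrite -(flS j)// -(flS j.+1)//; apply: up_avg_xlnx => X.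
exact: iter_up_avg_ge0.
Qed.

Lemma imset_setC_level (S : finType) n :
  (n <= #|S|)%N -> (@setC S) @: level S n = level S (#|S| - n).
Proof.
move=> nS; apply/setP => X; rewrite -[X]setCK mem_imset; last exact: setC_inj.
by rewrite !inE setCK -(cardsC X) in nS *; apply/eqP/eqP; lia.
Qed.

Definition subsets (S : finType) (m : nat) (X : {set S}) : {set {set S}} :=
  [set Y : {set S} | (Y \subset X) && (#|Y| == m)].

Lemma imset_setC_supersets (S : finType) m (X : {set S}) :
  (m <= #|S|)%N -> (@setC S) @: subsets m X = supersets (#|S| - m) (~: X).
Proof.
move=> mS; apply/setP => Y; rewrite -[Y]setCK mem_imset; last exact: setC_inj.
have := imset_setC_level mS => /setP/(_ (~: ~: Y)).
by rewrite mem_imset ?inE ?setCS => [->|]; last exact: setC_inj.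
Qed.

(** Complementation exchanges subsets of size [m] of [X] with supersets of size
    [#|S| - m] of [~: X], so this is [entropy_up] for [g] precomposed with
    complementation. *)
Theorem entropy_down (R : realType) (S : finType) (g : {set S} -> R) n m :
  (forall Y, 0 <= g Y) -> (m <= n)%N -> (n <= #|S|)%N ->
  (#|S| - m)%:R * entropy (unif R (level S n)) (fun X => avg (subsets m X) g) <=
  (#|S| - n)%:R * entropy (unif R (level S m)) g.
Proof.
move=> g0 mn nS; have mS := leq_trans mn nS.
have gC : g = g \o (@setC S) \o (@setC S).
  by apply: boolp.funext => X /=; rewrite setCK.
have -> : entropy (unif R (level S n)) (fun X => avg (subsets m X) g) =
    entropy (unif R (level S (#|S| - n)))
      (iter (#|S| - m - (#|S| - n)) (@up_avg R S) (g \o (@setC S))).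
  rewrite -imset_setC_level// entropy_imset; last exact: setC_inj.
  apply: eq_entropy_avg => X; rewrite inE => /eqP Xn.
  rewrite {1}gC -(avg_imset _ (g \o (@setC S)) (@setC_inj S)).
  rewrite imset_setC_supersets// /= (iter_up_avg _ (n := #|S| - m)) ?leq_subr//.
  by rewrite cardsCs setCK Xn subnKC// leq_sub2l.
rewrite {2}gC -(entropy_imset _ (g \o (@setC S)) (@setC_inj S)).
rewrite imset_setC_level//; apply: entropy_up => [Y||].
- exact: g0.
- exact: leq_sub2l.
- exact: leq_subr.
Qed.

(** * The down-up walk *)

(** Sets of bundled [n]-sets are transported to sets of sets, where functions of
    different levels live on one type. *)
Lemma imset_val_nset (S : finType) (n : nat) (P : pred {set S}) :
  (val : nset S n -> {set S}) @: [set X | P (val X)] =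
  [set X : {set S} | P X && (#|X| == n)].
Proof.
apply/setP => X; rewrite inE; apply/imsetP/andP => [[Y]|[PX Xn]].
  by rewrite inE => PY ->; split=> //; exact: (valP Y).
by exists (Sub X Xn : nset S n); rewrite ?inE ?SubK.
Qed.

Lemma down_upE (R : realType) (S : finType) (n k : nat) (F : {set S} -> R)
    (X : nset S n) :
  markov_op (down_up R S n k) (F \o val) X =
  avg (subsets (n - k) (val X)) (fun Y => avg (supersets n Y) F).
Proof.
rewrite /markov_op /down_up.
under eq_bigr do rewrite mulr_suml.
rewrite exchange_big /=.
rewrite -[subsets _ _](imset_val_nset (n - k) (fun Y => Y \subset val X)).
rewrite avg_imset; last exact: val_inj.
apply: eq_bigr => Y _; rewrite /down_step /up_step /=.
under eq_bigr do rewrite -mulrA.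
rewrite -mulr_sumr; congr (_ * _).
rewrite -[supersets _ _](imset_val_nset n (fun Z => val Y \subset Z)).
by rewrite avg_imset//; exact: val_inj.
Qed.

Lemma entropy_nset (R : realType) (S : finType) (n : nat) (F : {set S} -> R) :
  entropy (unif_nset R S n) (F \o val) = entropy (unif R (level S n)) F.
Proof.
have -> : level S n = (val : nset S n -> {set S}) @: [set: nset S n].
  by rewrite (imset_val_nset n predT) /level.
by rewrite entropy_imset//; exact: val_inj.
Qed.

Lemma down_up_contraction (R : realType) (S : finType) (n k : nat) :
  (0 < n < #|S|)%N -> (0 < k <= n)%N ->
  entropy_contraction (unif_nset R S n) (down_up R S n k)
    (k%:R / n%:R + k%:R / (#|S|%:R - (n%:R - k%:R)) * (1 - k%:R / n%:R)).
Proof.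
move=> /andP[n0 nS] /andP[k0 kn] f f0.
(* Extended by zero off level [n], [f] becomes a function of all sets. *)
pose F X := if insub X is Some x then f x else 0.
have F0 X : 0 <= F X by rewrite /F; case: insub.
have -> : f = F \o val by apply: boolp.funext => X; rewrite /F /= valK.
have -> : markov_op (down_up R S n k) (F \o val) =
    (fun X => avg (subsets (n - k) X) (iter k (@up_avg R S) F)) \o val.
  apply: boolp.funext => X; rewrite down_upE; apply: eq_avg => Y.
  rewrite inE => /andP[_ /eqP Yk].
  by rewrite (iter_up_avg _ (n := n)) ?(ltnW nS)// Yk subnK.
rewrite !entropy_nset.
have down := entropy_down (iter_up_avg_ge0 k ^~ F0) (leq_subr k n) (ltnW nS).
have := entropy_up F0 (leq_subr k n) (ltnW nS); rewrite subKn// => up.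
move: down up; move: (entropy _ _) => a; move: (entropy _ _) => b.
move: (entropy _ _) => c.
rewrite !natrB ?(ltnW nS) ?(leq_trans (leq_subr k n) (ltnW nS))// => down up.
have n0R : 0 < n%:R :> R by rewrite ltr0n.
have k0R : 0 < k%:R :> R by rewrite ltr0n.
have knR : k%:R <= n%:R :> R by rewrite ler_nat.
have nSR : n%:R < #|S|%:R :> R by rewrite ltr_nat.
have e0 : 0 < #|S|%:R - (n%:R - k%:R) :> R by lra.
rewrite -(ler_pM2l (mulr_gt0 n0R e0)).
have -> : n%:R * (#|S|%:R - (n%:R - k%:R)) * ((1 -
   (k%:R / n%:R + k%:R / (#|S|%:R - (n%:R - k%:R)) * (1 - k%:R / n%:R))) * c) =
   (#|S|%:R - n%:R) * ((n%:R - k%:R) * c).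
  by field; rewrite !lt0r_neq0.
apply: le_trans (_ : n%:R * ((#|S|%:R - n%:R) * b) <= _).
  by rewrite -mulrA ler_pM2l.
by rewrite mulrCA ler_pM2l// subr_gt0.
Qed.

Theorem theorem5 (R : realType) (S : finType) (N n : nat)
    (card_S : #|S| = N) (n_gt0 : (0 < n)%N) (n_ltN : (n < N)%N) :
  (forall theta : nat -> R,
      (forall k : nat, (1 <= k <= n)%N -> 0 <= theta k) ->
      \sum_(1 <= k < n.+1) theta k = 1 ->
      forall f : nset S n -> R, (forall X, 0 <= f X) ->
        \sum_(1 <= k < n.+1)
          theta k * entropy (unif_nset R S n)
                            (markov_op (down_up R S n k) f)
        <= (1 - (kappa0 n theta + kappa1 N n theta))
           * entropy (unif_nset R S n) f)
  /\
  (forall k : nat, (1 <= k <= n)%N ->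
      entropy_contraction (unif_nset R S n) (down_up R S n k)
        (k%:R / n%:R + k%:R / (N%:R - (n%:R - k%:R)) * (1 - k%:R / n%:R))).
Proof.
have contraction k : (1 <= k <= n)%N ->
    entropy_contraction (unif_nset R S n) (down_up R S n k)
      (k%:R / n%:R + k%:R / (N%:R - (n%:R - k%:R)) * (1 - k%:R / n%:R)).
  by rewrite -card_S; apply: down_up_contraction; rewrite n_gt0 card_S.
split=> // theta theta0 theta1 f f0.
(* The weights sum to one, so the constant [1] is a weighted sum as well. *)
rewrite -theta1 /kappa0 /kappa1 -big_split -sumrB mulr_suml /=.
rewrite !big_seq; apply: ler_sum => k; rewrite mem_index_iota ltnS => kn.
rewrite -mulrDr -{2}[theta k]mulr1 -mulrBr -(mulrA (theta k)).
rewrite ler_wpM2l ?theta0//; exact: contraction.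
Qed.
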